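(* Let $A\in\mathbb{C}^{m\times n}$ have rank $r$ and $W\in\mathbb{C}^{n\times m}$ have rank $s$, with singular value decompositions $$A=U\begin{pmatrix}\Sigma_1&0\\0&0\end{pmatrix}V^*\quad\text{and}\quad W=S\begin{pmatrix}\Sigma_2&0\\0&0\end{pmatrix}T^*,$$ where $U,T\in\mathbb{C}^{m\times m}$ and $V,S\in\mathbb{C}^{n\times n}$ are unitary, $\Sigma_1=\mathrm{diag}(\sigma_1,\dots,\sigma_r)$ with $\sigma_1\ge\cdots\ge\sigma_r>0$ and $\Sigma_2=\mathrm{diag}(\tau_1,\dots,\tau_s)$ with $\tau_1\ge\cdots\ge\tau_s>0$. Write $$T^*U=\begin{bmatrix}R_1&R_2\\R_3&R_4\end{bmatrix},\ R_1\in\mathbb{C}^{s\times r},\qquad V^*S=\begin{bmatrix}H_1&H_2\\H_3&H_4\end{bmatrix},\ H_1\in\mathbb{C}^{r\times s}.$$ Then $$A^{\mathrm{cEP},W}=U\begin{bmatrix}\Sigma_1H_1[(\Sigma_2R_1\Sigma_1H_1)^{\mathrm{cEP}}]^2&0\\0&0\end{bmatrix}S^*.$$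
   Context: For a square complex matrix $B$, $\mathrm{ind}(B)$ is the smallest non-negative integer $j$ with $\mathrm{rank}(B^j)=\mathrm{rank}(B^{j+1})$ (with $B^0=I$). $B^*$, $B^{\dagger}$ and $\mathcal{R}(B)$ denote the conjugate transpose, Moore-Penrose inverse and range (column space) of $B$. The core-EP inverse $B^{\mathrm{cEP}}$ of a square matrix $B$ is the unique $Y$ with $YB^{j+1}=B^j$, $BY^2=Y$ and $(BY)^*=BY$, where $j=\mathrm{ind}(B)$. For $A\in\mathbb{C}^{m\times n}$, $W\in\mathbb{C}^{n\times m}$ and $p=\max\{\mathrm{ind}(AW),\mathrm{ind}(WA)\}$, the $W$-weighted core-EP inverse $A^{\mathrm{cEP},W}$ is the unique $Y\in\mathbb{C}^{m\times n}$ with $WAWY=(WA)^p[(WA)^p]^{\dagger}$ and $\mathcal{R}(Y)\subseteq\mathcal{R}((AW)^p)$. *)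

(* Defs.v *)
From mathcomp Require Import all_boot all_order all_algebra.

Set Implicit Arguments.
Unset Strict Implicit.
Unset Printing Implicit Defensive.

Import Order.TTheory GRing.Theory Num.Theory.
Local Open Scope ring_scope.
Local Open Scope sesquilinear_scope.

Section Index.
Variables (F : fieldType) (k : nat).
Implicit Types B : 'M[F]_k.

Fact mxindex_exists B : exists j, \rank (B ^+ j) == \rank (B ^+ j.+1).
Proof.
have le j : (\rank (B ^+ j.+1) <= \rank (B ^+ j))%N.
  by rewrite exprS mxrankM_maxr.
case: (boolP [exists j : 'I_(\rank (B ^+ 0)).+1,
               \rank (B ^+ j) == \rank (B ^+ j.+1)]).
  by case/existsP=> j ?; exists j.
move/existsPn=> neq.
have lt j : (j <= (\rank (B ^+ 0)).+1 -> \rank (B ^+ j) + j <= \rank (B ^+ 0))%N.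
  elim: j => [|j IH] hj; first by rewrite addn0.
  rewrite addnS; apply: leq_trans (IH (ltnW hj)).
  by rewrite ltn_add2r ltn_neqAle le andbT eq_sym (neq (Ordinal hj)).
have := leq_trans (leq_addl _ _) (lt _ (leqnn _)).
by rewrite ltnn.
Qed.

Definition mxindex B : nat := ex_minn (mxindex_exists B).

Lemma mxindexP B : \rank (B ^+ mxindex B) = \rank (B ^+ (mxindex B).+1).
Proof. by rewrite /mxindex; case: ex_minnP => j /eqP. Qed.

Lemma mxindex_subl B : (B ^+ mxindex B <= B ^+ (mxindex B).+1)%MS.
Proof.
have := mxrank_leqif_sup (submxMl B (B ^+ mxindex B)).
by rewrite -[B *m _]/(B * _) -exprS mxindexP => /leqifP; case: ifP; rewrite ?ltnn.
Qed.

Lemma mxindex_left B : exists L, forall p, (mxindex B <= p)%N -> B ^+ p = L *m B ^+ p.+1.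
Proof.
have /submxP[L eL] := mxindex_subl B; exists L => p le.
rewrite -(subnKC le) -addSn !exprD.
by rewrite -[_ * _]/(_ *m _) {1}eL -mulmxA.
Qed.

Lemma mxindex_right B : exists M, forall p, (mxindex B <= p)%N -> B ^+ p = B ^+ p.+1 *m M.
Proof.
have : ((B ^+ mxindex B)^T <= (B ^+ (mxindex B).+1)^T)%MS.
  have := mxrank_leqif_sup (submxMl B^T (B ^+ mxindex B)^T).
  rewrite -trmx_mul -[_ *m B]/(_ * B) -exprSr !mxrank_tr mxindexP.
  by move=> /leqifP; case: ifP; rewrite ?ltnn.
case/submxP=> L /(congr1 trmx); rewrite trmx_mul !trmxK => eL; exists L^T => p le.
rewrite -(subnK le) -addnS !exprD.
by rewrite -!/(_ *m _) -mulmxA -eL.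
Qed.

Lemma mxindex_cancel B p q (m : nat) (K : 'M_(k, m)) : (mxindex B <= p)%N ->
  B ^+ (q + p) *m K = 0 -> B ^+ p *m K = 0.
Proof.
move=> le; elim: q => [//|q IH]; rewrite addSn => e; apply: IH.
have [L eL] := mxindex_left B.
by rewrite eL ?(leq_trans le (leq_addl _ _)) // -mulmxA e mulmx0.
Qed.

End Index.

Section GeneralizedInverses.
Variable C : numClosedFieldType.

Lemma mulmx_trC m n p (A : 'M[C]_(m, n)) (B : 'M[C]_(n, p)) :
  (A *m B)^t* = B^t* *m A^t*.
Proof. by rewrite trmx_mul map_mxM. Qed.

Lemma mul_mx_trC_eq0 m n (A : 'M[C]_(m, n)) : A *m A^t* = 0 -> A = 0.
Proof.
move=> e; apply/matrixP => i j; rewrite [RHS]mxE.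
have := congr1 (fun X => fun_of_matrix X i i) e; rewrite !mxE.
move/psumr_eq0P => /(_ _ j isT) H; apply/eqP.
rewrite -normr_eq0 -sqrf_eq0 normCK; apply/eqP.
by have := H _; rewrite !mxE; apply=> l _; rewrite !mxE -normCK exprn_ge0.
Qed.

Lemma row_free_gram m n (A : 'M[C]_(m, n)) : row_free A -> A *m A^t* \in unitmx.
Proof.
move=> fA; rewrite -row_free_unit -kermx_eq0; apply/eqP.
set K := kermx _.
apply: (row_free_inj fA); rewrite mul0mx; apply: mul_mx_trC_eq0.
by rewrite mulmx_trC mulmxA -(mulmxA K) mulmx_ker mul0mx.
Qed.

Definition penrose m n (B : 'M[C]_(m, n)) : pred 'M[C]_(n, m) := fun X =>
  [&& B *m X *m B == B, X *m B *m X == X,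
      (B *m X)^t* == B *m X & (X *m B)^t* == X *m B].

Fact penrose_exists m n (B : 'M[C]_(m, n)) : exists X, penrose B X.
Proof.
have fF : row_free (col_base B)^T.
  by rewrite /row_free mxrank_tr; exact: col_base_full.
move: (mulmx_base B) (row_base_free B) fF.
move: (\rank B) (col_base B) (row_base B) => r F G eB fG fF.
have uG : G *m G^t* \in unitmx by exact: row_free_gram.
have uF : F^t* *m F \in unitmx.
  rewrite -{2}[F](trmxCK F); apply: row_free_gram.
  by rewrite /row_free mxrank_map; exact: fF.
have hF : (invmx (F^t* *m F))^t* = invmx (F^t* *m F).
  by rewrite trmx_inv map_invmx mulmx_trC trmxCK.
have hG : (invmx (G *m G^t*))^t* = invmx (G *m G^t*).
  by rewrite trmx_inv map_invmx mulmx_trC trmxCK.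
set iF := invmx _ in hF; set iG := invmx _ in hG.
pose X := G^t* *m iG *m (iF *m F^t*).
have GX : G *m X = iF *m F^t* by rewrite /X !mulmxA mulmxV // mul1mx.
have XF : X *m F = G^t* *m iG by rewrite /X -!mulmxA mulVmx // mulmx1.
have BX : B *m X = F *m iF *m F^t* by rewrite -eB -(mulmxA F G) GX mulmxA.
have XB : X *m B = G^t* *m iG *m G by rewrite -eB (mulmxA X F) XF.
exists X; apply/and4P; split; apply/eqP.
- by rewrite BX -eB mulmxA -(mulmxA (F *m iF)) -(mulmxA F iF) mulVmx // mulmx1.
- by rewrite XB -(mulmxA _ G X) GX.
- by rewrite BX !mulmx_trC trmxCK hF mulmxA.
- by rewrite XB !mulmx_trC trmxCK hG mulmxA.
Qed.

Definition mpinv m n (B : 'M[C]_(m, n)) : 'M[C]_(n, m) := xchoose (penrose_exists B).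

Lemma mpinvP m n (B : 'M[C]_(m, n)) : penrose B (mpinv B).
Proof. exact: xchooseP. Qed.

Lemma penrose_unique m n (B : 'M[C]_(m, n)) X Y :
  penrose B X -> penrose B Y -> X = Y.
Proof.
case/and4P=> /eqP X1 /eqP X2 /eqP X3 /eqP X4.
case/and4P=> /eqP Y1 /eqP Y2 /eqP Y3 /eqP Y4.
have e1 : B *m X = B *m Y.
  by rewrite -X3 -{1}Y1 -mulmxA mulmx_trC X3 Y3 !mulmxA X1.
have e2 : X *m B = Y *m B.
  by rewrite -X4 -{1}Y1 !mulmxA -(mulmxA _ Y) mulmx_trC X4 Y4 -mulmxA (mulmxA B) X1.
by rewrite -X2 -mulmxA e1 mulmxA e2 Y2.
Qed.

Section CoreEP.
Variable k : nat.
Implicit Types B : 'M[C]_k.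

Definition is_coreEP B : pred 'M[C]_k := fun Y =>
  [&& Y *m B ^+ (mxindex B).+1 == B ^+ mxindex B, B *m (Y ^+ 2) == Y
    & (B *m Y)^t* == B *m Y].

Fact coreEP_exists B : exists Y, is_coreEP B Y.
Proof.
set j := mxindex B; have [M eM] := mxindex_right B.
pose D := B ^+ j; have /and4P[/eqP P1 _ /eqP P3 _] := mpinvP D.
pose Y := D *m M *m mpinv D.
have BD : B *m D = B ^+ j.+1 by rewrite -[_ *m _]/(_ * _) -exprS.
have BY : B *m Y = D *m mpinv D by rewrite /Y !mulmxA BD -eM.
exists Y; apply/and3P; split; apply/eqP; last by rewrite BY P3.
- have e : B ^+ 1 *m (Y *m B ^+ j.+1 - D) = 0.
    have DB : B ^+ j.+1 = D *m B by rewrite exprSr.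
    by rewrite expr1 mulmxBr mulmxA BY BD DB mulmxA P1 subrr.
  apply/eqP; rewrite -subr_eq0; apply/eqP.
  have eK : Y *m B ^+ j.+1 - D =
      B ^+ j *m (M *m mpinv D *m B ^+ j.+1 - 1%:M).
    by rewrite mulmxBr mulmx1 /Y /D !mulmxA.
  move: e; rewrite -/j -/D eK mulmxA -[_ *m B ^+ j]/(_ * _) -exprD.
  exact: mxindex_cancel.
- by rewrite expr2 -[Y * Y]/(Y *m Y) mulmxA BY {1 2}/Y !mulmxA P1.
Qed.

Definition coreEP B : 'M[C]_k := xchoose (coreEP_exists B).

Lemma coreEPP B : is_coreEP B (coreEP B).
Proof. exact: xchooseP. Qed.

Lemma is_coreEP_range B Y p : is_coreEP B Y -> Y = B ^+ p *m Y ^+ p.+1.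
Proof.
case/and3P=> _ /eqP Y2 _; elim: p => [|p IH]; first by rewrite mul1mx.
have e : Y ^+ p.+1 = B *m Y ^+ p.+2.
  by rewrite -[p.+2]/(2 + p)%N exprD exprS -{1}Y2 -!mulmxE mulmxA.
by rewrite {1}IH e mulmxA [B ^+ p.+1]exprSr mulmxE.
Qed.

(* B *m Y is the orthogonal projector onto the range of B ^+ p. *)
Lemma is_coreEP_proj B Y p : (mxindex B <= p)%N -> is_coreEP B Y ->
  B *m Y = B ^+ p *m mpinv (B ^+ p).
Proof.
move=> le hY; have /and3P[/eqP Y1 _ /eqP Y3] := hY.
have /and4P[/eqP P1 _ /eqP P3 _] := mpinvP (B ^+ p).
have [M eM] := mxindex_right B.
have e1 : B *m Y *m B ^+ p = B ^+ p.
  rewrite eM // mulmxA; congr (_ *m _).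
  have -> : p.+1 = ((mxindex B).+1 + (p - mxindex B))%N.
    by rewrite addSn subnKC.
  rewrite exprD -!mulmxE mulmxA -(mulmxA B) Y1.
  by rewrite [B ^+ (mxindex B).+1]exprS mulmxE.
set D := B ^+ p in P1 P3 e1 *.
have e2 : D *m mpinv D *m (B *m Y) = B *m Y.
  rewrite {1 2}(is_coreEP_range p hY) -/D !mulmxE (mulrA B) -exprS exprSr -/D.
  by rewrite !mulrA -!mulmxE P1.
by rewrite -Y3 -{1}e2 mulmx_trC P3 Y3 mulmxA e1.
Qed.

Lemma coreEP_unique B X Y : is_coreEP B X -> is_coreEP B Y -> X = Y.
Proof.
move=> hX hY; apply/eqP; rewrite -subr_eq0; apply/eqP.
have := is_coreEP_proj (leqnn _) hX; rewrite -(is_coreEP_proj (leqnn _) hY).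
move/eqP; rewrite -subr_eq0 -mulmxBr => /eqP.
rewrite (is_coreEP_range (mxindex B) hX) (is_coreEP_range (mxindex B) hY).
rewrite -mulmxBr mulmxA -{1}[B]expr1 -[_ *m B ^+ _]/(_ * _) -exprD.
exact: mxindex_cancel.
Qed.

End CoreEP.

Section WeightedCoreEP.
Variables m n : nat.
Implicit Types (A : 'M[C]_(m, n)) (W : 'M[C]_(n, m)).

Definition windex A W : nat := maxn (mxindex (A *m W)) (mxindex (W *m A)).

(* mathcomp's %MS compares row spaces, hence the transposes for column spaces *)
Definition is_wcoreEP A W : pred 'M[C]_(m, n) := fun Y =>
  let P := (W *m A) ^+ windex A W in
  (W *m A *m W *m Y == P *m mpinv P) && (Y^T <= ((A *m W) ^+ windex A W)^T)%MS.

Lemma mul_expr_swap A W p : A *m (W *m A) ^+ p = (A *m W) ^+ p *m A.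
Proof.
elim: p => [|p IH]; first by rewrite mulmx1 mul1mx.
by rewrite exprSr exprSr -!mulmxE !mulmxA IH.
Qed.

Fact wcoreEP_exists A W : exists Y, is_wcoreEP A W Y.
Proof.
pose X := coreEP (W *m A); have hX := coreEPP (W *m A).
have /and3P[_ /eqP X2 _] := hX; set p := windex A W.
have le : (mxindex (W *m A) <= p)%N by rewrite leq_maxr.
exists (A *m X ^+ 2); apply/andP; split.
  by rewrite -(is_coreEP_proj le hX) mulmxA -(mulmxA (W *m A)) -mulmxA X2.
apply/submxP; rewrite {1}expr2 -mulmxE {1}/X {1}(is_coreEP_range p hX).
rewrite !mulmxA mul_expr_swap -2!mulmxA trmx_mul.
by eexists.
Qed.

Definition wcoreEP A W : 'M[C]_(m, n) := xchoose (wcoreEP_exists A W).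

Lemma wcoreEPP A W : is_wcoreEP A W (wcoreEP A W).
Proof. exact: xchooseP. Qed.

Lemma wcoreEP_unique A W X Y : is_wcoreEP A W X -> is_wcoreEP A W Y -> X = Y.
Proof.
case/andP=> /eqP X1 /submxP[K /(congr1 trmx)]; rewrite trmx_mul !trmxK => eX.
case/andP=> /eqP Y1 /submxP[L /(congr1 trmx)]; rewrite trmx_mul !trmxK => eY.
apply/eqP; rewrite -subr_eq0; apply/eqP.
have : W *m A *m W *m (X - Y) = 0 by rewrite mulmxBr X1 Y1 subrr.
move/(congr1 (mulmx A)); rewrite mulmx0 eX eY -mulmxBr !mulmxA.
rewrite -(mulmxA (A *m W)) mulmxE -expr2 -exprD.
by apply: mxindex_cancel; rewrite leq_maxl.
Qed.

End WeightedCoreEP.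
End GeneralizedInverses.

(* the m x n matrix partitioned into four blocks, the upper left one being r x s *)
Definition partmx (T : Type) (m n r s : nat) (rm : (r <= m)%N) (sn : (s <= n)%N)
    (X : 'M[T]_(r, s)) (Y : 'M[T]_(r, n - s))
    (Z : 'M[T]_(m - r, s)) (Q : 'M[T]_(m - r, n - s)) : 'M[T]_(m, n) :=
  castmx (subnKC rm, subnKC sn) (block_mx X Y Z Q).

(* Main.v *)
Require Import Defs.
From mathcomp Require Import all_boot all_order all_algebra.
From mathcomp Require Import complex reals.

Set Implicit Arguments.
Unset Strict Implicit.
Unset Printing Implicit Defensive.

Import Order.TTheory GRing.Theory Num.Theory.
Local Open Scope ring_scope.
Local Open Scope complex_scope.
Local Open Scope sesquilinear_scope.

(** The value of the weighted core-EP inverse on (A, W) is governed by the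
    single square matrix W A: one has A^{cEP,W} = A [(W A)^{cEP}]^2
    ([wcoreEP_coreEP]), since the right-hand side satisfies both defining
    conditions.  It remains to compute the core-EP inverse of W A.

    The two singular value decompositions give a factorization W A = F G, where
    F consists of the first s columns of S, so that its columns are orthonormal,
    and G F = Sigma2 R1 Sigma1 H1.  The core-EP inverse passes through such a
    factorization: (F G)^{cEP} = F (G F)^{cEP} F^* ([coreEP_isometry]).  This
    rests on (F G)^{p+1} = F (G F)^p G, which moves powers of F G to powers of
    G F, and on the fact that conjugation by an isometry preserves
    self-adjointness.  As the indices of F G and G F may differ (by at most one),
    the argument uses that the equation Y B^{p+1} = B^p characterizes the
    core-EP inverse for any exponent p, not only for p = ind(B)
    ([coreEP_of_power]).

    Squaring, F^* F = 1 cancels in the middle, and A F is the first r columns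
    of U times Sigma1 H1, which is the claim.  The block bookkeeping is done by
    the partial identity matrices J = pid_mx: a matrix with a single nonzero
    block X is J X J, and the upper left block of M is J M J. *)

Section CoreEPFactorization.
Variable C : numClosedFieldType.

(** An equation Y B^{p+1} = B^p at one exponent p yields it at ind(B): multiply
    by a power of B to make p at least ind(B), then divide on the right, which
    is possible because B^j is a right multiple of B^{j+q} when j = ind(B). *)
Lemma coreEP_of_power k p (B Y : 'M[C]_k) :
    Y *m B ^+ p.+1 = B ^+ p -> B *m Y ^+ 2 = Y -> (B *m Y)^t* = B *m Y ->
  Y = coreEP B.
Proof.
move=> Y1 Y2 Y3; apply: coreEP_unique (coreEPP B).
apply/and3P; split; apply/eqP => //.
set j := mxindex B.
have [M eM] := mxindex_right B.
have [N eN] : exists N, B ^+ j = B ^+ (j + p) *m N.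
  elim: p {Y1} => [|q [N eN]]; first by exists 1%:M; rewrite addn0 mulmx1.
  exists (M *m N).
  by rewrite mulmxA addnS -eM ?leq_addr.
have YB q : Y *m B ^+ (q + p).+1 = B ^+ (q + p).
  by rewrite addnC -addSn !exprD -!mulmxE mulmxA Y1.
by rewrite exprS -mulmxE eN (mulmxA B) mulmxE -exprS -mulmxE mulmxA YB.
Qed.

Lemma expr_mul_swap n k p (F : 'M[C]_(n, k)) (G : 'M[C]_(k, n)) :
  (F *m G) ^+ p.+1 = F *m (G *m F) ^+ p *m G.
Proof. by rewrite exprSr -mulmxE mulmxA mul_expr_swap. Qed.

Lemma conj_isometry_sqr n k (F : 'M[C]_(n, k)) (X : 'M[C]_k) :
  F^t* *m F = 1%:M -> (F *m X *m F^t*) ^+ 2 = F *m X ^+ 2 *m F^t*.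
Proof.
by move=> FF; rewrite !expr2 -!mulmxE -!mulmxA (mulmxA (F^t*)) FF mul1mx.
Qed.

(** The core-EP inverse of a matrix factored through an isometry F: the
    orthogonal projector onto the range of a power of F G is the conjugate by F
    of the one for G F. *)
Lemma coreEP_isometry n k (F : 'M[C]_(n, k)) (G : 'M[C]_(k, n)) :
  F^t* *m F = 1%:M -> coreEP (F *m G) = F *m coreEP (G *m F) *m F^t*.
Proof.
move=> FF; have /and3P[/eqP X1 /eqP X2 /eqP X3] := coreEPP (G *m F).
set X := coreEP (G *m F) in X1 X2 X3 *.
have BY : F *m G *m (F *m X *m F^t*) = F *m (G *m F *m X) *m F^t*.
  by rewrite !mulmxA.
have YF : F *m X *m F^t* *m F = F *m X by rewrite -mulmxA FF mulmx1.
apply/esym/(@coreEP_of_power _ (mxindex (G *m F)).+1).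
- by rewrite !(expr_mul_swap _ F) !mulmxA YF -(mulmxA F X) X1.
- by rewrite conj_isometry_sqr // -[in RHS]X2 !mulmxA.
- by rewrite BY (mulmx_trC (F *m _)) (mulmx_trC F) trmxCK X3 mulmxA.
Qed.

Lemma wcoreEP_coreEP m n (A : 'M[C]_(m, n)) (W : 'M[C]_(n, m)) :
  wcoreEP A W = A *m coreEP (W *m A) ^+ 2.
Proof.
apply: wcoreEP_unique (wcoreEPP A W) _.
set X := coreEP _; have hX := coreEPP (W *m A).
have /and3P[_ /eqP X2 _] := hX; set p := windex A W.
have le : (mxindex (W *m A) <= p)%N by rewrite leq_maxr.
apply/andP; split.
  by rewrite -(is_coreEP_proj le hX) mulmxA -(mulmxA (W *m A)) -mulmxA X2.
(* X = (W A)^p X^{p+1} and A (W A)^p = (A W)^p A, which exhibits the range. *)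
apply/submxP; rewrite expr2 -mulmxE {1}/X (is_coreEP_range p hX).
rewrite !mulmxA mul_expr_swap -2!mulmxA trmx_mul.
by eexists.
Qed.

End CoreEPFactorization.

Section Partition.
Variables (K : pzRingType) (m n r s : nat) (rm : (r <= m)%N) (sn : (s <= n)%N).

(** Both facts reduce to block products once m and n are written as sums, with
    the partial identities as one-row or one-column block matrices. *)
Lemma partmx_ul (X : 'M[K]_(r, s)) :
  partmx rm sn X 0 0 0 = pid_mx r *m X *m pid_mx s.
Proof.
rewrite /partmx; move: (subnKC rm) (subnKC sn).
move: (m - r)%N (n - s)%N => m' n' em en.
case: m / em; case: n / en; rewrite castmx_id pid_mx_col pid_mx_row.
by rewrite mul_col_mx mul1mx mul0mx mul_col_mx mul_mx_row mulmx1 mulmx0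
  mul0mx -row_mx0.
Qed.

Lemma ul_partmx (X : 'M[K]_(r, s)) Y Z Q :
  pid_mx r *m partmx rm sn X Y Z Q *m pid_mx s = X.
Proof.
rewrite /partmx; move: Y Z Q (subnKC rm) (subnKC sn).
move: (m - r)%N (n - s)%N => m' n' Y Z Q em en.
case: m / em; case: n / en; rewrite castmx_id pid_mx_row pid_mx_col.
by rewrite mul_row_block !mul1mx !mul0mx !addr0 mul_row_col mulmx1 mulmx0 addr0.
Qed.

End Partition.

Theorem theorem2p4 (R : realType) (m n r s : nat)
    (A : 'M[R[i]]_(m, n)) (W : 'M[R[i]]_(n, m))
    (rm : (r <= m)%N) (rn : (r <= n)%N) (sm : (s <= m)%N) (sn : (s <= n)%N)
    (rankA : \rank A = r) (rankW : \rank W = s)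
    (U T : 'M[R[i]]_m) (V S : 'M[R[i]]_n)
    (sigma : 'I_r -> R) (tau : 'I_s -> R)
    (Sigma1 : 'M[R[i]]_r) (Sigma2 : 'M[R[i]]_s)
    (R1 : 'M[R[i]]_(s, r)) (R2 : 'M[R[i]]_(s, m - r))
    (R3 : 'M[R[i]]_(m - s, r)) (R4 : 'M[R[i]]_(m - s, m - r))
    (H1 : 'M[R[i]]_(r, s)) (H2 : 'M[R[i]]_(r, n - s))
    (H3 : 'M[R[i]]_(n - r, s)) (H4 : 'M[R[i]]_(n - r, n - s))
    (unitU : U \is unitarymx) (unitT : T \is unitarymx)
    (unitV : V \is unitarymx) (unitS : S \is unitarymx)
    (sigma_gt0 : forall i, 0 < sigma i)
    (sigma_noninc : forall i j : 'I_r, (i <= j)%N -> sigma j <= sigma i)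
    (tau_gt0 : forall i, 0 < tau i)
    (tau_noninc : forall i j : 'I_s, (i <= j)%N -> tau j <= tau i)
    (defSigma1 : Sigma1 = diag_mx (\row_i (sigma i)%:C))
    (defSigma2 : Sigma2 = diag_mx (\row_i (tau i)%:C))
    (svdA : A = U *m partmx rm rn Sigma1 0 0 0 *m V^t*)
    (svdW : W = S *m partmx sn sm Sigma2 0 0 0 *m T^t*)
    (blockR : T^t* *m U = partmx sm rm R1 R2 R3 R4)
    (blockH : V^t* *m S = partmx rn sn H1 H2 H3 H4) :
  wcoreEP A W =
    U *m partmx rm sn
           (Sigma1 *m H1 *m coreEP (Sigma2 *m R1 *m Sigma1 *m H1) ^+ 2) 0 0 0
      *m S^t*.
Proof.
have FF : (S *m pid_mx s :> 'M_(n, s))^t* *m (S *m pid_mx s) = 1%:M.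
  have SS : S^t* *m S = 1%:M by apply: mulmx1C; apply/unitarymxP.
  rewrite mulmx_trC tr_pid_mx map_pid_mx -mulmxA (mulmxA _ S) SS mul1mx.
  by rewrite mul_pid_mx minnn (minn_idPr sn) pid_mx_1.
have eR : pid_mx s *m T^t* *m U *m pid_mx r = R1.
  by rewrite -(mulmxA _ (T^t*)) blockR ul_partmx.
have eH : pid_mx r *m V^t* *m S *m pid_mx s = H1.
  by rewrite -(mulmxA _ (V^t*)) blockH ul_partmx.
set F := S *m pid_mx s in FF.
pose G : 'M_(s, n) := Sigma2 *m R1 *m Sigma1 *m pid_mx r *m V^t*.
have WA : W *m A = F *m G.
  by rewrite svdA svdW !partmx_ul /G -eR /F !mulmxA.
have GF : G *m F = Sigma2 *m R1 *m Sigma1 *m H1.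
  by rewrite /G /F -eH !mulmxA.
have AF : A *m F = U *m pid_mx r *m Sigma1 *m H1.
  by rewrite svdA partmx_ul /F -eH !mulmxA.
rewrite wcoreEP_coreEP WA (coreEP_isometry _ FF) GF partmx_ul.
by rewrite conj_isometry_sqr // -(mulmxA F) (mulmxA A) AF /F mulmx_trC tr_pid_mx map_pid_mx !mulmxA.
Qed.
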